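(* Let $\theta:A\to B$ be a differentiable algebra map. There is a functor $\theta_*:{}_A\mathcal{E}\to{}_B\mathcal{E}$ defined on objects by $\theta_*(E,\nabla)=(B\otimes_AE,\hat\nabla)$, where $B$ is a right $A$-module by $b\triangleleft a=b\,\theta(a)$ and $$\hat\nabla:B\otimes_AE\to\Omega^1B\otimes_BB\otimes_AE=\Omega^1B\otimes_AE,\qquad \hat\nabla(b\otimes e)=b.(\theta_*\otimes\mathrm{id})(\nabla e)+\mathrm{d}b\otimes e,$$ and sending a morphism $\phi:E\to F$ to $\mathrm{id}\otimes\phi:B\otimes_AE\to B\otimes_AF$. Further, this functor restricts to a functor from ${}_A\mathcal{F}$ to ${}_B\mathcal{F}$.
   Context: Algebras are unital over a field $k$. A differential calculus on $A$ is a differential graded algebra $(\mathrm{d},\Omega^*A)$ with $\Omega^0A=A$ and product $\wedge$. An algebra map $\theta:A\to B$ between algebras with differential calculi is differentiable if it extends to a map $\theta_*:\Omega^*A\to\Omega^*B$ of differential graded algebras. A connection on a left $A$-module $E$ is a linear map $\nabla:E\to\Omega^1A\otimes_AE$ with $\nabla(a.e)=\mathrm{d}a\otimes e+a\nabla e$. ${}_A\mathcal{E}$ is the category of left $A$-modules with connection; its morphisms are the left $A$-module maps $\phi$ with $\nabla\circ\phi=(\mathrm{id}\otimes\phi)\circ\nabla$. The connection is flat if $\nabla^{[1]}\nabla=0$, where $\nabla^{[1]}(\omega\otimes e)=\mathrm{d}\omega\otimes e-\omega\wedge\nabla e$. ${}_A\mathcal{F}$ is the full subcategory of ${}_A\mathcal{E}$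 consisting of modules with flat connection. *)

(* Defs.v *)
From HB Require Import structures.
From mathcomp Require Import all_boot all_algebra.
From mathcomp Require Import generic_quotient ring_quotient boolp.
From mathcomp.multinomials Require Import freeg.

Set Implicit Arguments.
Unset Strict Implicit.
Unset Printing Implicit Defensive.

Import GRing.Theory.
Local Open Scope ring_scope.
Local Open Scope quotient_scope.

(* A unital associative k-algebra is a ring with a ring map from k to its
   centre, the scalar action being c.a = kmap c * a. The library's algType is
   not used because it excludes the zero algebra. *)
HB.mixin Record isKAlgebra (k : pzRingType) A of GRing.PzRing A := {
  kmap : {rmorphism k -> A};
  kmapC : forall (c : k) (a : A), kmap c * a = a * kmap c }.

#[short(type="kalgType")]
HB.structure Definition KAlgebra (k : pzRingType) :=
  {A of isKAlgebra k A & GRing.PzRing A}.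

Arguments kmap {k} A : rename.

HB.mixin Record Lmodule_isBimodule (B A : pzRingType) M
    of GRing.Lmodule B M := {
  ract : M -> A -> M;
  ractDl : forall m m' a, ract (m + m') a = ract m a + ract m' a;
  ractDr : forall m a a', ract m (a + a') = ract m a + ract m a';
  ractA : forall m a a', ract (ract m a) a' = ract m (a * a');
  ract1 : forall m, ract m 1 = m;
  ractZ : forall b m a, ract (b *: m) a = b *: ract m a }.

#[short(type="bimodType")]
HB.structure Definition Bimodule (B A : pzRingType) :=
  {M of Lmodule_isBimodule B A M & GRing.Lmodule B M}.

Notation "m ◁ a" := (ract m a) (at level 40, left associativity) : ring_scope.

Section Regular.
Variable R : pzRingType.

HB.instance Definition _ := Lmodule_isBimodule.Build R R R^o
  (@mulrDl R) (@mulrDr R) (fun m a a' => esym (mulrA m a a')) (@mulr1 R)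
  (fun b m a => esym (mulrA b m a)).
End Regular.

Section ZmodSpan.
Variables (V : zmodType) (gen : V -> Prop).

Definition zmod_span : {pred V} := fun x =>
  `[< forall S : zmodClosed V, (forall g, gen g -> g \in S) -> x \in S >].

Lemma zmod_spanP : zmod_closed zmod_span.
Proof.
split=> [|x y /asboolP Sx /asboolP Sy]; apply/asboolP=> S genS.
  exact: rpred0.
by apply: rpredB; [apply: Sx | apply: Sy].
Qed.

HB.instance Definition _ := GRing.isZmodClosed.Build V zmod_span zmod_spanP.

Lemma zmod_span_gen g : gen g -> g \in (zmod_span : zmodClosed V).
Proof. by move=> gg; apply/asboolP=> S; apply. Qed.
End ZmodSpan.

Section Ker.
Variables (V W : zmodType) (f : {additive V -> W}).
Definition ker_pred : {pred V} := fun x => f x == 0.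
Lemma ker_predP : zmod_closed ker_pred.
Proof.
split=> [|x y /eqP fx /eqP fy]; rewrite unfold_in /ker_pred ?raddf0 //.
by rewrite raddfB fx fy subr0.
Qed.
HB.instance Definition _ := GRing.isZmodClosed.Build V ker_pred ker_predP.
End Ker.

Section Tensor.
Variables (B A : pzRingType) (M : bimodType B A) (N : lmodType A).

Inductive tensor_rel : {freeg (M * N) / int} -> Prop :=
| TensorDl m m' n : tensor_rel (<<(m + m', n)>> - <<(m, n)>> - <<(m', n)>>)
| TensorDr m n n' : tensor_rel (<<(m, n + n')>> - <<(m, n)>> - <<(m, n')>>)
| TensorA m a n : tensor_rel (<<(m ◁ a, n)>> - <<(m, a *: n)>>).

Definition tensor : Type := Quotient.quot (zmod_span tensor_rel).
HB.instance Definition _ := GRing.Zmodule.on tensor.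
HB.instance Definition _ := Quotient.on tensor.

Definition ten (m : M) (n : N) : tensor := \pi_tensor <<(m, n)>>.

Definition tensor_pi : {additive _ -> tensor} :=
  \pi_(Quotient.quot (zmod_span tensor_rel)).

Lemma tensor_piB x y : \pi_tensor (x - y) = \pi_tensor x - \pi_tensor y.
Proof. exact: (raddfB tensor_pi). Qed.

Lemma tensor_pi_rel x : tensor_rel x -> \pi_tensor x = 0.
Proof.
move=> rx; rewrite -[0](raddf0 tensor_pi).
by apply/eqP; rewrite -Quotient.idealrBE subr0 zmod_span_gen.
Qed.

Lemma tenDl m m' n : ten (m + m') n = ten m n + ten m' n.
Proof.
by apply/eqP; rewrite -subr_eq0 opprD addrA -!tensor_piB (tensor_pi_rel (TensorDl _ _ _)).
Qed.

Lemma tenDr m n n' : ten m (n + n') = ten m n + ten m n'.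
Proof.
by apply/eqP; rewrite -subr_eq0 opprD addrA -!tensor_piB (tensor_pi_rel (TensorDr _ _ _)).
Qed.

Lemma tenA m a n : ten (m ◁ a) n = ten m (a *: n).
Proof.
by apply/eqP; rewrite -subr_eq0 -tensor_piB (tensor_pi_rel (TensorA _ _ _)).
Qed.

Lemma ten0l n : ten 0 n = 0.
Proof. by apply: (addIr (ten 0 n)); rewrite -tenDl !add0r. Qed.

Lemma tenNl m n : ten (- m) n = - ten m n.
Proof. by apply/eqP; rewrite -addr_eq0 -tenDl addNr ten0l. Qed.

Lemma tensor_ind (P : tensor -> Prop) :
    (forall m n, P (ten m n)) -> (forall t u, P t -> P u -> P (t + u)) ->
  forall t, P t.
Proof.
move=> Pten PD; have P0 : P 0 by rewrite -(ten0l 0).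
have PN m n : P (- ten m n) by rewrite -tenNl.
have PM m n (i : int) : P (ten m n *~ i).
  case: i => i; first by elim: i => // i IH; rewrite -pmulrn mulrS; apply: PD.
  rewrite NegzE -nmulrn; elim: i.+1 => [|j IH]; first by rewrite oppr0.
  by rewrite mulrS opprD; apply: PD.
move=> t; rewrite -[t]reprK -[repr t]freeg_sumE [\pi_tensor _](raddf_sum tensor_pi).
elim/big_ind: _ => // -[m n] _.
rewrite -[coeff _ _]intz -freegU_mulz [tensor_pi _](raddfMz tensor_pi); exact: PM.
Qed.

Section Lift.
Variables (G : zmodType) (f : M -> N -> G).

Record balanced : Prop := Balanced {
  balDl : forall m m' n, f (m + m') n = f m n + f m' n;
  balDr : forall m n n', f m (n + n') = f m n + f m n';
  balA : forall m a n, f (m ◁ a) n = f m (a *: n) }.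

Definition free_lift (x : {freeg (M * N) / int}) : G :=
  fglift (fun z : M * N => f z.1 z.2 : zmodule G) x.

Lemma free_lift_is_zmod_morphism : zmod_morphism free_lift.
Proof. exact: (@lift_is_additive _ _ (zmodule G)). Qed.
HB.instance Definition _ := GRing.isZmodMorphism.Build _ _ free_lift free_lift_is_zmod_morphism.

(* The additive map m ⊗ n |-> f m n, by the universal property. *)
Definition tensor_lift (bf : balanced) (t : tensor) : G := free_lift (repr t).

Variable bf : balanced.

Lemma free_liftU m n : free_lift <<(m, n)>> = f m n.
Proof. by rewrite /free_lift liftU /= [LHS]mulr1z. Qed.

Lemma free_lift_rel x : x \in zmod_span tensor_rel -> free_lift x = 0.
Proof.
move/asboolP=> /(_ (ker_pred free_lift)) H; apply/eqP/H=> _ [m m' n|m n n'|m a n];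
  rewrite unfold_in /= /ker_pred !raddfB /= !free_liftU.
- by rewrite (balDl bf) addrAC addrK subrr.
- by rewrite (balDr bf) addrAC addrK subrr.
- by rewrite (balA bf) subrr.
Qed.

Lemma free_lift_pi x y : \pi_tensor x = \pi_tensor y -> free_lift x = free_lift y.
Proof.
by move/eqP; rewrite -Quotient.idealrBE => /free_lift_rel /eqP;
  rewrite raddfB subr_eq0 => /eqP.
Qed.

Lemma tensor_liftE m n : tensor_lift bf (ten m n) = f m n.
Proof. by rewrite -free_liftU; apply: free_lift_pi; rewrite reprK. Qed.

Lemma tensor_lift_is_zmod_morphism : zmod_morphism (tensor_lift bf).
Proof.
move=> t u; rewrite /tensor_lift -[RHS](raddfB free_lift); apply: free_lift_pi.
by rewrite tensor_piB !reprK.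
Qed.
HB.instance Definition _ :=
  GRing.isZmodMorphism.Build _ _ (tensor_lift bf) tensor_lift_is_zmod_morphism.
End Lift.

Lemma tensor_ext (G : zmodType) (f g : {additive tensor -> G}) :
  (forall m n, f (ten m n) = g (ten m n)) -> f =1 g.
Proof. by move=> fg; elim/tensor_ind=> // t u ft fu; rewrite !raddfD ft fu. Qed.

Lemma tensor_scale_balanced (b : B) :
  balanced (fun m n => ten (b *: m) n).
Proof.
by split=> *; rewrite ?scalerDr ?tenDl ?tenDr // -tenA ractZ.
Qed.

(* The left B-action b.(m ⊗ n) = (b.m) ⊗ n. *)
Definition tensor_scale b : tensor -> tensor :=
  tensor_lift (tensor_scale_balanced b).
HB.instance Definition _ b := GRing.Additive.on (tensor_scale b).

Lemma tensor_scaleE b m n : tensor_scale b (ten m n) = ten (b *: m) n.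
Proof. exact: tensor_liftE. Qed.

Lemma tensor_scalerA a b t : tensor_scale a (tensor_scale b t) = tensor_scale (a * b) t.
Proof.
elim/tensor_ind: t => [m n|t u Ht Hu]; first by rewrite !tensor_scaleE scalerA.
by rewrite !raddfD /= Ht Hu.
Qed.

Lemma tensor_scale1r : left_id 1 tensor_scale.
Proof.
elim/tensor_ind=> [m n|t u Ht Hu]; first by rewrite tensor_scaleE scale1r.
by rewrite raddfD /= Ht Hu.
Qed.

Lemma tensor_scalerDl t : {morph tensor_scale^~ t : a b / a + b}.
Proof.
move=> a b; elim/tensor_ind: t => [m n|t u Ht Hu].
  by rewrite !tensor_scaleE scalerDl tenDl.
by rewrite !raddfD /= Ht Hu addrACA.
Qed.

HB.instance Definition _ := GRing.Zmodule_isLmodule.Build B tensor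
  tensor_scalerA tensor_scale1r (fun b => raddfD (tensor_scale b)) tensor_scalerDl.

Lemma tenZ b m n : b *: ten m n = ten (b *: m) n.
Proof. exact: tensor_scaleE. Qed.
End Tensor.

Notation "m ⊗ n" := (ten m n) (at level 40, left associativity) : ring_scope.

Record rlinear (B C A : pzRingType) (M : bimodType B A) (M' : bimodType C A) :=
  RLinear {
    rlin_fun :> M -> M';
    rlinD : forall x y, rlin_fun (x + y) = rlin_fun x + rlin_fun y;
    rlinA : forall x a, rlin_fun (x ◁ a) = rlin_fun x ◁ a }.

Definition rlin_id (B A : pzRingType) (M : bimodType B A) : rlinear M M :=
  RLinear (rlin_fun := id) (fun _ _ => erefl) (fun _ _ => erefl).

Section TensorMap.
Variables (B C A : pzRingType) (M : bimodType B A) (M' : bimodType C A).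
Variables (N N' : lmodType A) (f : rlinear M M') (g : {linear N -> N'}).

Lemma tensor_map_balanced : balanced (fun m n => f m ⊗ g n).
Proof.
by split=> *; rewrite ?rlinD ?rlinA ?raddfD ?tenDl ?tenDr ?tenA ?linearZ.
Qed.

Definition tensor_map : tensor M N -> tensor M' N' :=
  tensor_lift tensor_map_balanced.
HB.instance Definition _ := GRing.Additive.on tensor_map.

Lemma tensor_mapE m n : tensor_map (m ⊗ n) = f m ⊗ g n.
Proof. exact: tensor_liftE. Qed.
End TensorMap.

Lemma tensor_map_idZ (B A : pzRingType) (M : bimodType B A)
    (N N' : lmodType A) (g : {linear N -> N'}) b t :
  tensor_map (rlin_id M) g (b *: t) = b *: tensor_map (rlin_id M) g t.
Proof.
elim/tensor_ind: t => [m n|t u Ht Hu]; first by rewrite tenZ !tensor_mapE tenZ.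
by rewrite scalerDr !raddfD /= Ht Hu.
Qed.
HB.instance Definition _ (B A : pzRingType) (M : bimodType B A)
    (N N' : lmodType A) (g : {linear N -> N'}) :=
  GRing.isScalable.Build B (tensor M N) (tensor M N') *:%R
    (tensor_map (rlin_id M) g) (@tensor_map_idZ B A M N N' g).

Definition restrict (A B C : pzRingType) (theta : {rmorphism A -> B})
  (M : bimodType C B) : Type := M.

Section Restrict.
Variables (A B : pzRingType) (theta : {rmorphism A -> B}).
Variables (C : pzRingType) (M : bimodType C B).
Local Notation restrict := (restrict theta M).

HB.instance Definition _ := GRing.Lmodule.on restrict.

Definition restrict_ract (m : restrict) (a : A) : restrict := (m : M) ◁ theta a.

Lemma restrict_ractDl m m' a :
  restrict_ract (m + m') a = restrict_ract m a + restrict_ract m' a.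
Proof. exact: ractDl. Qed.
Lemma restrict_ractDr m a a' :
  restrict_ract m (a + a') = restrict_ract m a + restrict_ract m a'.
Proof. by rewrite /restrict_ract rmorphD ractDr. Qed.
Lemma restrict_ractA m a a' :
  restrict_ract (restrict_ract m a) a' = restrict_ract m (a * a').
Proof. by rewrite /restrict_ract ractA rmorphM. Qed.
Lemma restrict_ract1 m : restrict_ract m 1 = m.
Proof. by rewrite /restrict_ract rmorph1 ract1. Qed.
Lemma restrict_ractZ c m a :
  restrict_ract (c *: m) a = c *: restrict_ract m a.
Proof. exact: ractZ. Qed.

HB.instance Definition _ := Lmodule_isBimodule.Build C A restrict
  restrict_ractDl restrict_ractDr restrict_ractA restrict_ract1 restrict_ractZ.
End Restrict.

(* The identification M ⊗_A E = M ⊗_B (B ⊗_A E) for a right B-module M, where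
   theta : A -> B makes M and B right A-modules: insert1 and absorb below are
   inverse to each other. *)
Section BaseChange.
Variables (A B : pzRingType) (theta : {rmorphism A -> B}).

Definition base_change (E : lmodType A) : lmodType B :=
  tensor (restrict theta B^o) E.

Variables (C : pzRingType) (M : bimodType C B) (E : lmodType A).
Implicit Types (m : M) (e : E).

Local Notation one := ((1 : B) : restrict theta B^o).

Lemma insert1_balanced :
  balanced (fun (m : restrict theta M) e => (m : M) ⊗ (one ⊗ e : base_change E)).
Proof.
split=> [m m' e|m e e'|m a e]; rewrite ?tenDl ?tenDr //.
rewrite [LHS]tenA tenZ -tenA; congr (_ ⊗ (_ ⊗ _)).
by rewrite [LHS]mulr1 [RHS]mul1r.
Qed.

(* m ⊗ e |-> m ⊗ (1 ⊗ e) *)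
Definition insert1 : tensor (restrict theta M) E -> tensor M (base_change E) :=
  tensor_lift insert1_balanced.
HB.instance Definition _ := GRing.Additive.on insert1.

Lemma absorb_balanced1 m :
  balanced (fun (b : restrict theta B^o) e => (m ◁ (b : B) : restrict theta M) ⊗ e).
Proof.
split=> [b b' e|b e e'|b a e]; rewrite ?ractDr ?tenDl ?tenDr //.
by rewrite -tenA; congr (_ ⊗ _); rewrite [RHS]ractA.
Qed.

Lemma absorb_balanced :
  balanced (fun m (t : base_change E) => tensor_lift (absorb_balanced1 m) t).
Proof.
split=> [m m' t|m t t'|m b t]; last 2 first.
- by rewrite raddfD.
- elim/tensor_ind: t => [c e|t u Ht Hu]; last by rewrite scalerDr !raddfD /= Ht Hu.
  by rewrite tenZ !tensor_liftE ractA.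
elim/tensor_ind: t => [c e|t u Ht Hu].
  by rewrite !tensor_liftE -tenDl; congr (_ ⊗ _); rewrite ractDl.
by rewrite !raddfD /= Ht Hu addrACA.
Qed.

(* m ⊗ (b ⊗ e) |-> mb ⊗ e *)
Definition absorb : tensor M (base_change E) -> tensor (restrict theta M) E :=
  tensor_lift absorb_balanced.
HB.instance Definition _ := GRing.Additive.on absorb.

Lemma insert1K : cancel insert1 absorb.
Proof.
elim/tensor_ind=> [m e|t u Ht Hu]; last by rewrite !raddfD /= Ht Hu.
by rewrite /insert1 tensor_liftE /absorb !tensor_liftE ract1.
Qed.

Lemma absorbK : cancel absorb insert1.
Proof.
elim/tensor_ind=> [m t|t u Ht Hu]; last by rewrite !raddfD /= Ht Hu.
elim/tensor_ind: t => [b e|t u Ht Hu].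
  rewrite /absorb !tensor_liftE /insert1 tensor_liftE tenA tenZ.
  by congr (_ ⊗ (_ ⊗ _)); apply: mulr1.
by rewrite tenDr !raddfD /= Ht Hu.
Qed.
End BaseChange.

Definition dcast (k : pzRingType) (F : nat -> lmodType k) (m n : nat)
  (e : m = n) (x : F m) : F n := ecast i (F i) e x.

Record dga (k : fieldType) := Dga {
  form :> nat -> lmodType k;
  wedge : forall m n, form m -> form n -> form (m + n)%N;
  form1 : form 0;
  dd : forall n, form n -> form n.+1;
  wedgeDl : forall m n (x y : form m) (z : form n),
    wedge (x + y) z = wedge x z + wedge y z;
  wedgeDr : forall m n (x : form m) (y z : form n),
    wedge x (y + z) = wedge x y + wedge x z;
  wedgeZl : forall m n (c : k) (x : form m) (y : form n),
    wedge (c *: x) y = c *: wedge x y;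
  wedgeZr : forall m n (c : k) (x : form m) (y : form n),
    wedge x (c *: y) = c *: wedge x y;
  wedgeA : forall m n p (x : form m) (y : form n) (z : form p),
    wedge x (wedge y z) = dcast (esym (addnA m n p)) (wedge (wedge x y) z);
  wedge1l : forall n (x : form n), wedge form1 x = x;
  wedge1r : forall n (x : form n), wedge x form1 = dcast (esym (addn0 n)) x;
  ddD : forall n (x y : form n), dd (x + y) = dd x + dd y;
  ddZ : forall n (c : k) (x : form n), dd (c *: x) = c *: dd x;
  ddK : forall n (x : form n), dd (dd x) = 0;
  ddM : forall m n (x : form m) (y : form n),
    dd (wedge x y) =
    wedge (dd x) y + (-1) ^+ m *: dcast (addnS m n) (wedge x (dd y)) }.

Arguments wedge {k d m n}.
Arguments form1 {k d}.
Arguments dd {k d n}.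
Notation "x ∧ y" := (wedge x y) (at level 40, left associativity) : ring_scope.

(* A differential calculus on A: a dga whose degree 0 algebra is identified
   with A by incl. *)
Record calculus (k : fieldType) (A : kalgType k) := Calculus {
  calc :> dga k;
  incl : A -> calc 0;
  incl_bij : bijective incl;
  inclD : forall a b, incl (a + b) = incl a + incl b;
  inclM : forall a b, incl (a * b) = incl a ∧ incl b;
  incl1 : incl 1 = form1;
  inclZ : forall c a, incl (kmap A c * a) = c *: incl a }.

Section DcastTheory.
Variables (k : fieldType) (O : dga k).

Lemma dcast_id n (e : n = n) (x : O n) : dcast e x = x.
Proof. by rewrite eq_axiomK. Qed.

Lemma dcastK m n p (e : m = n) (e' : n = p) (e'' : m = p) (x : O m) :
  dcast e' (dcast e x) = dcast e'' x.
Proof. by case: p / e' e''; case: n / e => e''; rewrite !dcast_id. Qed.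

Lemma dcastD m n (e : m = n) (x y : O m) :
  dcast e (x + y) = dcast e x + dcast e y.
Proof. by case: n / e. Qed.

Lemma dcast_wedgel m n p (e : m = n) (e' : (m + p = n + p)%N)
  (x : O m) (y : O p) : dcast e x ∧ y = dcast e' (x ∧ y).
Proof. by case: n / e e' => e'; rewrite !dcast_id. Qed.

Lemma dcast_wedger m n p (e : m = n) (e' : (p + m = p + n)%N)
  (x : O p) (y : O m) : x ∧ dcast e y = dcast e' (x ∧ y).
Proof. by case: n / e e' => e'; rewrite !dcast_id. Qed.
End DcastTheory.

(* The A-bimodule of n-forms, A acting through incl and the wedge product. *)
Section Forms.
Variables (k : fieldType) (A : kalgType k) (Omega : calculus A) (n : nat).

Definition forms : Type := Omega n.
HB.instance Definition _ := GRing.Zmodule.on forms.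

Implicit Types (x y : forms) (a b : A).

Definition forms_lact a x : forms := incl Omega a ∧ (x : Omega n).
Definition forms_ract x a : forms :=
  dcast (addn0 n) ((x : Omega n) ∧ incl Omega a).

Lemma forms_lactA a b x : forms_lact a (forms_lact b x) = forms_lact (a * b) x.
Proof.
rewrite /forms_lact inclM.
by rewrite [LHS](@wedgeA _ _ 0 0 n (incl Omega a) (incl Omega b)) dcast_id.
Qed.
Lemma forms_lact1 : left_id 1 forms_lact.
Proof. by move=> x; rewrite /forms_lact incl1 wedge1l. Qed.
Lemma forms_lactDr : right_distributive forms_lact +%R.
Proof. by move=> a x y; exact: (@wedgeDr _ Omega 0 n). Qed.
Lemma forms_lactDl x : {morph forms_lact^~ x : a b / a + b}.
Proof. by move=> a b; rewrite /forms_lact inclD wedgeDl. Qed.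

HB.instance Definition _ := GRing.Zmodule_isLmodule.Build A forms
  forms_lactA forms_lact1 forms_lactDr forms_lactDl.

Lemma forms_ractDl x y a :
  forms_ract (x + y) a = forms_ract x a + forms_ract y a.
Proof. by rewrite /forms_ract wedgeDl dcastD. Qed.
Lemma forms_ractDr x a b :
  forms_ract x (a + b) = forms_ract x a + forms_ract x b.
Proof. by rewrite /forms_ract inclD wedgeDr dcastD. Qed.
Lemma forms_ractA x a b :
  forms_ract (forms_ract x a) b = forms_ract x (a * b).
Proof.
rewrite /forms_ract inclM (@wedgeA _ Omega n 0 0 x (incl Omega a)).
rewrite (dcast_wedgel _ (congr1 (addn^~ 0%N) (addn0 n))).
have e : (n + 0 + 0 = n)%N by rewrite !addn0.
by rewrite !(dcastK _ _ e).
Qed.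
Lemma forms_ract1 x : forms_ract x 1 = x.
Proof. by rewrite /forms_ract incl1 wedge1r (dcastK _ _ (erefl n)) dcast_id. Qed.
Lemma forms_ractZ a x b : forms_ract (a *: x) b = a *: forms_ract x b.
Proof.
rewrite /forms_ract /GRing.scale /= /forms_lact.
rewrite [RHS](@dcast_wedger _ Omega _ _ 0 (addn0 n) (addn0 n)).
by rewrite (@wedgeA _ Omega 0 n 0) (dcastK _ _ (addn0 n)).
Qed.

HB.instance Definition _ := Lmodule_isBimodule.Build A A forms
  forms_ractDl forms_ractDr forms_ractA forms_ract1 forms_ractZ.
End Forms.

Section Connections.
Variables (k : fieldType) (A : kalgType k) (Omega : calculus A).

(* The differential on degree 0, A -> Omega^1. *)
Definition d0 (a : A) : forms Omega 1 := dd (incl Omega a).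

(* Left connections on the left A-module E; the k-linear structures are those
   induced by kmap. *)
Record connection (E : lmodType A) := Connection {
  nabla :> E -> tensor (forms Omega 1) E;
  nablaD : forall e f, nabla (e + f) = nabla e + nabla f;
  nablaZ : forall (c : k) e, nabla (kmap A c *: e) = kmap A c *: nabla e;
  nablaM : forall a e, nabla (a *: e) = d0 a ⊗ e + a *: nabla e }.

(* The right A-linear map eta |-> omega ∧ eta on 1-forms. *)
Section WedgeL.
Variable omega : forms Omega 1.

Definition wedgel_fun (eta : forms Omega 1) : forms Omega 2 :=
  (omega : Omega 1) ∧ (eta : Omega 1).
Lemma wedgel_funD x y : wedgel_fun (x + y) = wedgel_fun x + wedgel_fun y.
Proof. exact: (@wedgeDr _ Omega 1 1). Qed.
Lemma wedgel_funA x a : wedgel_fun (x ◁ a) = wedgel_fun x ◁ a.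
Proof.
rewrite /wedgel_fun /ract /= /forms_ract !dcast_id.
by have := @wedgeA _ Omega 1 1 0 omega x (incl Omega a); rewrite dcast_id.
Qed.
Definition wedgel := RLinear wedgel_funD wedgel_funA.
End WedgeL.

Variables (E : lmodType A) (D : connection E).

(* omega ∧ t for t in Omega^1 ⊗ E, with omega ∧ (eta ⊗ e) = (omega ∧ eta) ⊗ e *)
Definition wedge_tensor (omega : forms Omega 1) :
  tensor (forms Omega 1) E -> tensor (forms Omega 2) E :=
  tensor_map (wedgel omega) idfun.
HB.instance Definition _ omega := GRing.Additive.on (wedge_tensor omega).

Lemma wedge_tensorDl x y t :
  wedge_tensor (x + y) t = wedge_tensor x t + wedge_tensor y t.
Proof.
elim/tensor_ind: t => [m n|t u Ht Hu]; last by rewrite !raddfD /= Ht Hu addrACA.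
by rewrite /wedge_tensor !tensor_mapE -tenDl; congr (_ ⊗ _); exact: (@wedgeDl _ Omega 1 1).
Qed.

Lemma wedge_tensorA x a t :
  wedge_tensor (x ◁ a) t = wedge_tensor x (a *: t).
Proof.
elim/tensor_ind: t => [m n|t u Ht Hu].
  rewrite tenZ /wedge_tensor !tensor_mapE; congr (_ ⊗ _).
  rewrite /= /wedgel_fun /ract /GRing.scale /= /forms_ract /forms_lact.
  rewrite dcast_id; symmetry.
  by have := @wedgeA _ Omega 1 0 1 x (incl Omega a) m; rewrite dcast_id.
by rewrite scalerDr !raddfD /= Ht Hu.
Qed.

Definition d1 (omega : forms Omega 1) : forms Omega 2 := dd (omega : Omega 1).

Lemma d1D x y : d1 (x + y) = d1 x + d1 y.
Proof. exact: (@ddD _ Omega 1). Qed.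

Lemma d1_ract omega a :
  d1 (omega ◁ a) = d1 omega ◁ a - wedgel omega (d0 a).
Proof.
rewrite /d1 /ract /= /forms_ract !dcast_id.
by rewrite [LHS](@ddM _ Omega 1 0) expr1 scaleN1r !dcast_id.
Qed.

Lemma nabla1_balanced :
  balanced (fun (omega : forms Omega 1) e =>
    d1 omega ⊗ e - wedge_tensor omega (D e)).
Proof.
split=> [x y e|x e f|x a e].
- by rewrite d1D tenDl wedge_tensorDl opprD addrACA.
- by rewrite tenDr nablaD raddfD /= opprD addrACA.
rewrite d1_ract nablaM raddfD tenDl tenA tenNl /= wedge_tensorA opprD addrA.
by rewrite /wedge_tensor tensor_mapE.
Qed.

(* nabla^[1] (omega ⊗ e) = d omega ⊗ e - omega ∧ nabla e *)
Definition nabla1 : tensor (forms Omega 1) E -> tensor (forms Omega 2) E :=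
  tensor_lift nabla1_balanced.

Definition flat := forall e, nabla1 (D e) = 0.
End Connections.

Record category := Category {
  obj :> Type;
  mor : obj -> obj -> Type;
  idmor : forall X, mor X X;
  compm : forall X Y Z, mor Y Z -> mor X Y -> mor X Z;
  compmA : forall X Y Z W (h : mor Z W) (g : mor Y Z) (f : mor X Y),
    compm h (compm g f) = compm (compm h g) f;
  comp1m : forall X Y (f : mor X Y), compm (idmor Y) f = f;
  compm1 : forall X Y (f : mor X Y), compm f (idmor X) = f }.

Arguments idmor {c} X.
Arguments compm {c X Y Z}.

Record functor_on (C D : category) (F : C -> D) := FunctorOn {
  fmap : forall X Y : C, mor X Y -> mor (F X) (F Y);
  fmap1 : forall X, fmap (idmor X) = idmor (F X);
  fmapM : forall X Y Z (g : mor Y Z) (f : mor X Y),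
    fmap (compm g f) = compm (fmap g) (fmap f) }.

Definition full_subcategory (C : category) (P : C -> Prop) : category :=
  @Category {X : C | P X} (fun X Y => mor (sval X) (sval Y))
    (fun X => idmor (sval X)) (fun X Y Z g f => compm g f)
    (fun X Y Z W => @compmA C _ _ _ _) (fun X Y => @comp1m C _ _)
    (fun X Y => @compm1 C _ _).

Section ConnModules.
Variables (k : fieldType) (A : kalgType k) (Omega : calculus A).

Record cmodule := CModule {
  cmod_sort :> lmodType A;
  cmod_conn : connection Omega cmod_sort }.

Record cmod_hom (E F : cmodule) := CModHom {
  cmod_fun :> {linear E -> F};
  cmod_funP : forall e, cmod_conn F (cmod_fun e) =
    tensor_map (rlin_id (forms Omega 1)) cmod_fun (cmod_conn E e) }.

Lemma cmod_hom_eq (E F : cmodule) (f g : cmod_hom E F) : f =1 g -> f = g.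
Proof.
case: f g => [f fP] [g gP] /= fg.
suff e : f = g by case: g / e gP {fg} => gP; rewrite (Prop_irrelevance fP gP).
case: f g {fP gP} fg => [f [[a] [b]]] [g [[a'] [b']]] /= /funext fg.
case: g / fg a' b' => a' b'.
by rewrite (Prop_irrelevance a a') (Prop_irrelevance b b').
Qed.

Lemma cmod_id_subproof (E : cmodule) e :
  cmod_conn E e = tensor_map (rlin_id (forms Omega 1)) idfun (cmod_conn E e).
Proof.
elim/tensor_ind: (cmod_conn E e) => [m n|t u Ht Hu]; first by rewrite tensor_mapE.
by rewrite raddfD /= -Ht -Hu.
Qed.
Definition cmod_id (E : cmodule) : cmod_hom E E :=
  CModHom (cmod_fun := idfun) (@cmod_id_subproof E).

Lemma cmod_comp_subproof (E F G : cmodule) (g : cmod_hom F G) (f : cmod_hom E F) e :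
  cmod_conn G (g (f e)) =
  tensor_map (rlin_id (forms Omega 1)) (cmod_fun g \o cmod_fun f) (cmod_conn E e).
Proof.
rewrite !cmod_funP; elim/tensor_ind: (cmod_conn E e) => [m n|t u Ht Hu].
  by rewrite !tensor_mapE.
by rewrite !raddfD /= Ht Hu.
Qed.
Definition cmod_comp (E F G : cmodule) (g : cmod_hom F G) (f : cmod_hom E F) :
    cmod_hom E G :=
  CModHom (cmod_fun := cmod_fun g \o cmod_fun f) (cmod_comp_subproof g f).

Lemma cmod_compA (E F G H : cmodule) (h : cmod_hom G H) (g : cmod_hom F G)
  (f : cmod_hom E F) :
  cmod_comp h (cmod_comp g f) = cmod_comp (cmod_comp h g) f.
Proof. exact: cmod_hom_eq. Qed.
Lemma cmod_comp1m (E F : cmodule) (f : cmod_hom E F) :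
  cmod_comp (cmod_id F) f = f.
Proof. exact: cmod_hom_eq. Qed.
Lemma cmod_compm1 (E F : cmodule) (f : cmod_hom E F) :
  cmod_comp f (cmod_id E) = f.
Proof. exact: cmod_hom_eq. Qed.

(* _A E *)
Definition conn_cat : category := Category cmod_compA cmod_comp1m cmod_compm1.

Definition flat_conn (E : conn_cat) : Prop := flat (cmod_conn E).
(* _A F *)
Definition flat_cat : category := full_subcategory flat_conn.
End ConnModules.

(* theta is differentiable when this type is inhabited; such an extension need
   not be unique, since a calculus on A is not assumed to be generated by A. *)
Record dga_extension (k : fieldType) (A B : kalgType k) (OA : calculus A)
    (OB : calculus B) (theta : {rmorphism A -> B}) := DgaExtension {
  ext : forall n, OA n -> OB n;
  extD : forall n (x y : OA n), ext (x + y) = ext x + ext y;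
  extZ : forall n (c : k) (x : OA n), ext (c *: x) = c *: ext x;
  ext1 : ext (form1 : OA 0) = form1;
  extM : forall m n (x : OA m) (y : OA n), ext (x ∧ y) = ext x ∧ ext y;
  ext_dd : forall n (x : OA n), ext (dd x) = dd (ext x);
  ext0 : forall a, ext (incl OA a) = incl OB (theta a) }.

Section Ext.
Variables (k : fieldType) (A B : kalgType k) (OA : calculus A) (OB : calculus B).
Variables (theta : {rmorphism A -> B}) (thetas : dga_extension OA OB theta).

Definition ext_forms_fun n (x : forms OA n) : restrict theta (forms OB n) :=
  ext thetas (x : OA n).
Lemma ext_forms_funD n (x y : forms OA n) :
  ext_forms_fun (x + y) = ext_forms_fun x + ext_forms_fun y.
Proof. exact: (@extD _ _ _ _ _ _ thetas n). Qed.
Lemma ext_dcast m n (e : m = n) (x : OA m) :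
  ext thetas (dcast e x) = dcast e (ext thetas x).
Proof. by case: n / e. Qed.
Lemma ext_forms_funA n (x : forms OA n) a :
  ext_forms_fun (x ◁ a) = ext_forms_fun x ◁ a.
Proof.
rewrite /ext_forms_fun /ract /= /restrict_ract /ract /= /forms_ract.
by rewrite ext_dcast extM ext0.
Qed.

(* theta_* on n-forms, as a map of right A-modules. *)
Definition ext_forms n : rlinear (forms OA n) (restrict theta (forms OB n)) :=
  RLinear (@ext_forms_funD n) (@ext_forms_funA n).
End Ext.

(* Main.v *)
Require Import Defs.
From HB Require Import structures.
From mathcomp Require Import all_boot all_algebra.

Set Implicit Arguments.
Unset Strict Implicit.
Unset Printing Implicit Defensive.

Import GRing.Theory.
Local Open Scope ring_scope.

(** Let [D] be a connection on [E], [D'] the one to be built on [B ⊗_A E], and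
    [D1], [D1'] their extensions to 1-forms with coefficients. The formula for
    [D' (b ⊗ e)] respects the tensor relation [b theta(a) ⊗ e = b ⊗ a e] because
    the term [b d(theta a)] of [d(b theta(a))] is the image under [theta_*] of
    the term [da ⊗ e] of [D (a e)] ([pushforward_balanced]). The Leibniz rule
    for [D'] is then that of [d] on [B], and linearity over the ground field
    follows from it because [d] kills scalars. A morphism [phi] acts on the last
    tensor factor only, while [theta_*] and the identification
    [Omega^1 B ⊗_A E = Omega^1 B ⊗_B B ⊗_A E] act on the first, so [id ⊗ phi]
    commutes with the pushed forward connections.

    For flatness, the curvature [D1' D'] is linear over [B], like that of any
    connection ([curvatureZ]), so it is determined by its values on the elements
    [1 ⊗ e]. There [d 1 = 0] gives [D' (1 ⊗ e) = theta_*(D e)], and since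
    [theta_*] commutes with both [d] and the product, [D1' (theta_*(D e))] is
    [theta_*(D1 (D e))] ([nabla1_pushforward]), which vanishes when [D] is
    flat. *)

(** * The Leibniz rule and the curvature *)

Section Curvature.
Variables (k : fieldType) (A : kalgType k) (Omega : calculus A).

Lemma d0D a b : d0 Omega (a + b) = d0 Omega a + d0 Omega b.
Proof. by rewrite /d0 inclD [LHS]ddD. Qed.

Lemma d0M a b : d0 Omega (a * b) = d0 Omega a ◁ b + a *: d0 Omega b.
Proof.
rewrite /d0 inclM [LHS](@ddM _ Omega 0 0) expr0 scale1r.
by rewrite /ract /= /forms_ract !dcast_id.
Qed.

(** Leibniz for [1 = 1 * 1] reads [d 1 = d 1 + d 1]. *)
Lemma d0_1 : d0 Omega 1 = 0.
Proof.
have := d0M 1 1; rewrite mulr1 ract1 scale1r => /esym/eqP.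
by rewrite -subr_eq0 addrK => /eqP.
Qed.

Lemma d0_kmap c : d0 Omega (kmap A c) = 0.
Proof.
rewrite -[kmap A c]mulr1 /d0 inclZ [LHS](@ddZ _ Omega 0).
by have := d0_1; rewrite /d0 => ->; rewrite [LHS]scaler0.
Qed.

Lemma d1_d0 a : d1 (d0 Omega a) = 0.
Proof. exact: (@ddK _ Omega 0). Qed.

Lemma d1_scale a (w : forms Omega 1) :
  d1 (a *: w) = wedgel (d0 Omega a) w + a *: d1 w.
Proof.
by rewrite /d1 [LHS](@ddM _ Omega 0 1) expr0 scale1r dcast_id.
Qed.

Section Module.
Variable E : lmodType A.

Lemma wedge_tensorZ a (w : forms Omega 1) (t : tensor (forms Omega 1) E) :
  wedge_tensor (a *: w) t = a *: wedge_tensor w t.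
Proof.
elim/tensor_ind: t => [m n|t u Ht Hu]; last by rewrite !raddfD /= Ht Hu.
rewrite /wedge_tensor !tensor_mapE tenZ; congr (_ ⊗ _).
by have := @wedgeA _ Omega 0 1 1 (incl Omega a) w m; rewrite dcast_id => /esym.
Qed.

(** Scalars are closed, so their Leibniz term [dc ⊗ e] vanishes. *)
Lemma kmap_linear_of_leibniz (D : E -> tensor (forms Omega 1) E) :
  (forall a e, D (a *: e) = d0 Omega a ⊗ e + a *: D e) ->
  forall (c : k) e, D (kmap A c *: e) = kmap A c *: D e.
Proof. by move=> DM c e; rewrite DM d0_kmap ten0l add0r. Qed.

Variable D : connection Omega E.
HB.instance Definition _ := GRing.Additive.on (nabla1 D).

Lemma nabla1E w e : nabla1 D (w ⊗ e) = d1 w ⊗ e - wedge_tensor w (D e).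
Proof. exact: tensor_liftE. Qed.

(** The term [da ∧ t] added by this Leibniz rule is what makes the curvature
    linear. *)
Lemma nabla1Z a t :
  nabla1 D (a *: t) = wedge_tensor (d0 Omega a) t + a *: nabla1 D t.
Proof.
elim/tensor_ind: t => [w e|t u Ht Hu]; last first.
  by rewrite scalerDr !raddfD /= Ht Hu addrACA.
rewrite tenZ !nabla1E d1_scale tenDl wedge_tensorZ scalerBr tenZ addrA.
by rewrite /wedge_tensor tensor_mapE.
Qed.

Lemma curvatureD e f :
  nabla1 D (D (e + f)) = nabla1 D (D e) + nabla1 D (D f).
Proof. by rewrite nablaD raddfD. Qed.

(** Expanding [D (a e)] produces [- da ∧ D e] from [da ⊗ e] and [+ da ∧ D e]
    from [a D e]; they cancel, and [d (da) = 0]. *)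
Lemma curvatureZ a e : nabla1 D (D (a *: e)) = a *: nabla1 D (D e).
Proof.
by rewrite nablaM raddfD /= nabla1E nabla1Z d1_d0 ten0l sub0r addKr.
Qed.
End Module.
End Curvature.

(** * The identification of the two tensor products *)

Section BaseChangeTheory.
Variables (A B : pzRingType) (theta : {rmorphism A -> B}).
Variables (C : pzRingType) (M : bimodType C B).

Lemma insert1E (E : lmodType A) (m : M) (e : E) :
  insert1 ((m : restrict theta M) ⊗ e) =
  m ⊗ (((1 : B) : restrict theta B^o) ⊗ e : base_change theta E).
Proof. exact: tensor_liftE. Qed.

Lemma insert1Z (E : lmodType A) c (t : tensor (restrict theta M) E) :
  insert1 (c *: t) = c *: insert1 t.
Proof.
elim/tensor_ind: t => [m e|t u Ht Hu]; first by rewrite tenZ !insert1E tenZ.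
by rewrite scalerDr !raddfD /= Ht Hu.
Qed.

Lemma insert1_natural (E F : lmodType A) (phi : {linear E -> F})
    (t : tensor (restrict theta M) E) :
  tensor_map (rlin_id M) (tensor_map (rlin_id (restrict theta B^o)) phi)
    (insert1 t) = insert1 (tensor_map (rlin_id (restrict theta M)) phi t).
Proof.
elim/tensor_ind: t => [m e|t u Ht Hu]; last by rewrite !raddfD /= Ht Hu.
by rewrite insert1E !tensor_mapE insert1E /= tensor_mapE.
Qed.

(** Lets a [B]-linear map on the base change be tested on the [1 ⊗ e]. *)
Lemma ten_one (E : lmodType A) (b : B) (e : E) :
  ((b : restrict theta B^o) ⊗ e : base_change theta E) =
  b *: (((1 : B) : restrict theta B^o) ⊗ e : base_change theta E).
Proof. by rewrite [RHS]tenZ; congr (_ ⊗ _); rewrite [RHS]mulr1. Qed.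
End BaseChangeTheory.

(** * The connection on the base change *)

Section Pushforward.
Variables (k : fieldType) (A B : kalgType k) (OA : calculus A) (OB : calculus B).
Variables (theta : {rmorphism A -> B}) (thetas : dga_extension OA OB theta).

Lemma ext_formsZ n a (w : forms OA n) :
  ext_forms thetas n (a *: w) = theta a *: ext_forms thetas n w.
Proof. by rewrite [LHS](@extM _ _ _ _ _ _ thetas 0 n) ext0. Qed.

Lemma ext_d0 a : ext_forms thetas 1 (d0 OA a) = d0 OB (theta a).
Proof. by rewrite [LHS](@ext_dd _ _ _ _ _ _ thetas 0) ext0. Qed.

Lemma ext_d1 (w : forms OA 1) :
  ext_forms thetas 2 (d1 w) = d1 (ext_forms thetas 1 w : forms OB 1).
Proof. exact: (@ext_dd _ _ _ _ _ _ thetas 1). Qed.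

Section Object.
Variable E : lmodType A.

Definition ext_tensor n :
    tensor (forms OA n) E -> tensor (restrict theta (forms OB n)) E :=
  tensor_map (ext_forms thetas n) idfun.
HB.instance Definition _ n := GRing.Additive.on (@ext_tensor n).

Lemma ext_tensorE n (w : forms OA n) (e : E) :
  ext_tensor (w ⊗ e) = ext_forms thetas n w ⊗ e.
Proof. exact: tensor_mapE. Qed.

Lemma ext_tensorZ n a (t : tensor (forms OA n) E) :
  ext_tensor (a *: t) = theta a *: ext_tensor t.
Proof.
elim/tensor_ind: t => [m e|t u Ht Hu].
  by rewrite tenZ !ext_tensorE ext_formsZ tenZ.
by rewrite scalerDr !raddfD /= Ht Hu.
Qed.

Lemma wedge_tensor_ext (w : forms OA 1) (t : tensor (forms OA 1) E) :
  wedge_tensor (ext_forms thetas 1 w : forms OB 1) (insert1 (ext_tensor t)) =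
  insert1 (ext_tensor (wedge_tensor w t)).
Proof.
elim/tensor_ind: t => [m e|t u Ht Hu]; last by rewrite !raddfD /= Ht Hu.
rewrite ext_tensorE insert1E /wedge_tensor !tensor_mapE ext_tensorE insert1E.
by congr (_ ⊗ _); rewrite [RHS](@extM _ _ _ _ _ _ thetas 1 1).
Qed.

Variable D : connection OA E.

(** Both sides of the balancing condition contain
    [b d(theta a) ⊗ e + b theta(a) theta_*(D e) + db ⊗ a e]: the first term
    comes from [d (b theta(a))] on one side and from [theta_*(da ⊗ e)] on the
    other. *)
Lemma pushforward_balanced :
  balanced (fun (b : restrict theta B^o) e =>
    (b : B) *: ext_tensor (D e)
      + (d0 OB b : restrict theta (forms OB 1)) ⊗ e).
Proof.
split=> [b b' e|b e f|b a e].
- by rewrite scalerDl d0D tenDl addrACA.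
- by rewrite nablaD raddfD scalerDr tenDr addrACA.
rewrite nablaM raddfD /= ext_tensorZ ext_tensorE ext_d0 scalerDr tenZ scalerA.
have -> : (d0 OB (b ◁ a) : restrict theta (forms OB 1))
  = (d0 OB b : restrict theta (forms OB 1)) ◁ a
    + (b : B) *: (d0 OB (theta a) : restrict theta (forms OB 1)).
  exact: d0M.
by rewrite tenDl tenA addrC [X in X + _ = _]addrC [RHS]addrAC.
Qed.

Definition pushforward_fun :
    base_change theta E -> tensor (forms OB 1) (base_change theta E) :=
  @insert1 A B theta B (forms OB 1) E \o tensor_lift pushforward_balanced.
HB.instance Definition _ := GRing.Additive.on pushforward_fun.

Lemma pushforward_funE (b : B) (e : E) :
  pushforward_fun ((b : restrict theta B^o) ⊗ e) =
  insert1 (b *: ext_tensor (D e)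
    + (d0 OB b : restrict theta (forms OB 1)) ⊗ e).
Proof. by rewrite /pushforward_fun /= tensor_liftE. Qed.

Lemma pushforward_fun1 (e : E) :
  pushforward_fun (((1 : B) : restrict theta B^o) ⊗ e) = insert1 (ext_tensor (D e)).
Proof. by rewrite pushforward_funE d0_1 ten0l addr0 scale1r. Qed.

Lemma pushforward_funM b t :
  pushforward_fun (b *: t) = d0 OB b ⊗ t + b *: pushforward_fun t.
Proof.
elim/tensor_ind: t => [c e|t u Ht Hu]; last first.
  by rewrite scalerDr !raddfD /= Ht Hu tenDr addrACA.
rewrite tenZ !pushforward_funE -insert1Z scalerDr scalerA tenZ.
have -> : (d0 OB (b *: c) : restrict theta (forms OB 1))
  = (d0 OB b ◁ (c : B) : restrict theta (forms OB 1))
    + b *: (d0 OB c : restrict theta (forms OB 1)).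
  exact: d0M.
by rewrite tenDl ten_one -tenA !raddfD /= insert1E addrCA.
Qed.

Definition pushforward : connection OB (base_change theta E) :=
  Connection (raddfD pushforward_fun) (kmap_linear_of_leibniz pushforward_funM)
    pushforward_funM.

(** Because [theta_*] commutes with [d] and with the product, and the pushed
    forward connection has no [db ⊗ e] term at [1 ⊗ e]. *)
Lemma nabla1_pushforward t :
  nabla1 pushforward (insert1 (ext_tensor t)) = insert1 (ext_tensor (nabla1 D t)).
Proof.
elim/tensor_ind: t => [w e|t u Ht Hu]; last by rewrite !raddfD /= Ht Hu.
rewrite ext_tensorE insert1E !nabla1E /= pushforward_fun1 wedge_tensor_ext.
by rewrite !raddfB /= ext_tensorE insert1E ext_d1.
Qed.

(** The curvature is linear over [B], so only the elements [1 ⊗ e] matter. *)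
Lemma pushforward_flat : flat D -> flat pushforward.
Proof.
move=> flatD; elim/tensor_ind=> [b e|t u Ht Hu]; last first.
  by rewrite curvatureD Ht Hu addr0.
by rewrite ten_one curvatureZ /= pushforward_fun1 nabla1_pushforward flatD !raddf0.
Qed.
End Object.

(** * Functoriality *)

Section Morphism.
Variables (E F : cmodule OA) (phi : cmod_hom E F).

Lemma ext_tensor_natural n (t : tensor (forms OA n) E) :
  ext_tensor (tensor_map (rlin_id (forms OA n)) phi t) =
  tensor_map (rlin_id (restrict theta (forms OB n))) phi (ext_tensor t).
Proof.
elim/tensor_ind: t => [w e|t u Ht Hu]; last by rewrite !raddfD /= Ht Hu.
by rewrite ext_tensorE !tensor_mapE ext_tensorE.
Qed.

Definition pushforward_cmod (E : cmodule OA) : cmodule OB :=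
  CModule (pushforward (cmod_conn E)).

Lemma pushforward_hom_subproof (t : base_change theta E) :
  pushforward (cmod_conn F) (tensor_map (rlin_id (restrict theta B^o)) phi t) =
  tensor_map (rlin_id (forms OB 1))
    (tensor_map (rlin_id (restrict theta B^o)) phi) (pushforward (cmod_conn E) t).
Proof.
rewrite /=; elim/tensor_ind: t => [b e|t u Ht Hu]; last by rewrite !raddfD /= Ht Hu.
rewrite tensor_mapE !pushforward_funE insert1_natural; congr (insert1 _).
rewrite raddfD /= tensor_map_idZ tensor_mapE cmod_funP.
by rewrite ext_tensor_natural.
Qed.

Definition pushforward_hom : cmod_hom (pushforward_cmod E) (pushforward_cmod F) :=
  @CModHom _ _ _ (pushforward_cmod E) (pushforward_cmod F)
    (tensor_map (rlin_id (restrict theta B^o)) phi) pushforward_hom_subproof.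
End Morphism.

Lemma pushforward_hom1 (E : cmodule OA) :
  pushforward_hom (cmod_id E) = cmod_id (pushforward_cmod E).
Proof.
apply: cmod_hom_eq => /=; elim/tensor_ind=> [b e|t u Ht Hu].
  by rewrite tensor_mapE.
by rewrite raddfD /= Ht Hu.
Qed.

Lemma pushforward_homM (E F G : cmodule OA) (g : cmod_hom F G) (f : cmod_hom E F) :
  pushforward_hom (cmod_comp g f) = cmod_comp (pushforward_hom g) (pushforward_hom f).
Proof.
apply: cmod_hom_eq => /=; elim/tensor_ind=> [b e|t u Ht Hu].
  by rewrite /= !tensor_mapE.
by rewrite /= !raddfD /= Ht Hu.
Qed.
End Pushforward.

Theorem theorem2p9 (k : fieldType) (A B : kalgType k)
    (OA : calculus A) (OB : calculus B)
    (theta : {rmorphism A -> B})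
    (theta_lin : forall c : k, theta (kmap A c) = kmap B c)
    (thetas : dga_extension OA OB theta) :
  exists nabla_hat : forall X : conn_cat OA, connection OB (base_change theta X),
    (forall (X : conn_cat OA) (b : B) (e : X),
       nabla_hat X ((b : restrict theta B^o) ⊗ e) =
       insert1
         (b *: tensor_map (ext_forms thetas 1) idfun (cmod_conn X e)
          + (d0 OB b : restrict theta (forms OB 1)) ⊗ e)) /\
    exists F : functor_on
        (fun X : conn_cat OA => CModule (nabla_hat X) : conn_cat OB),
      (forall (X Y : conn_cat OA) (phi : mor X Y) (t : base_change theta X),
         cmod_fun (fmap F phi) t =
         tensor_map (rlin_id (restrict theta B^o)) (cmod_fun phi) t) /\
      exists (flat_hat : forall X : conn_cat OA,
                flat_conn X -> flat_conn (CModule (nabla_hat X) : conn_cat OB))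
             (G : functor_on (fun X : flat_cat OA =>
                exist _ (CModule (nabla_hat (sval X))) (flat_hat (sval X) (svalP X))
                : flat_cat OB)),
        forall (X Y : flat_cat OA) (phi : mor X Y), fmap G phi = fmap F phi.
Proof.
pose F := @FunctorOn (conn_cat OA) (conn_cat OB) (pushforward_cmod thetas)
  (@pushforward_hom _ _ _ _ _ _ thetas) (pushforward_hom1 thetas)
  (@pushforward_homM _ _ _ _ _ _ thetas).
have flat_hat (X : conn_cat OA) :
    flat_conn X -> flat_conn (pushforward_cmod thetas X : conn_cat OB).
  exact: pushforward_flat.
exists (fun X => pushforward thetas (cmod_conn X)); split.
  by move=> X b e; exact: (pushforward_funE thetas (cmod_conn X) b e).
exists F; split=> //; exists flat_hat.
(* morphisms of flat modules are morphisms of the underlying modules *)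
by exists (@FunctorOn (flat_cat OA) (flat_cat OB)
  (fun X => exist _ (pushforward_cmod thetas (sval X))
                    (flat_hat (sval X) (svalP X)))
  (fun X Y (phi : mor X Y) => @fmap _ _ _ F (sval X) (sval Y) phi)
  (fun X => fmap1 F (sval X))
  (fun X Y Z => @fmapM _ _ _ F (sval X) (sval Y) (sval Z))).
Qed.
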